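(* Let $\mathbb{F}$ be a field with involution $\overline{\,\cdot\,}$, let $m,n\ge 1$, let $x,y\in\mathbb{F}^m$ and $z,w\in\mathbb{F}^n$ be column vectors with all entries nonzero, let $a,b\in\mathbb{F}\setminus\{0\}$, and let $$M=\left[\begin{array}{cc|cc}0&x^T&a&0\\ y&0&0&0\\ \hline b&0&0&z^T\\ 0&0&w&0\end{array}\right]$$ (a square matrix of order $m+n+2$). Put $s=\sum_i x_i\overline{x_i}$, $u=\sum_i y_i\overline{y_i}$, $t=\sum_i z_i\overline{z_i}$, $v=\sum_i w_i\overline{w_i}$. Assume $x^Ty\neq 0$, $z^Tw\neq 0$ and $s,u,t,v\neq 0$. Then: (1) $M$ is core invertible and $$M^{\mathrm{core}}=\left[\begin{array}{cc|cc}0&u^{-1}y^*&0&0\\ (x^Ty)^{-1}y&0&0&-av^{-1}(x^Ty)^{-1}yw^*\\ \hline 0&0&0&v^{-1}w^*\\ 0&-bu^{-1}(z^Tw)^{-1}wy^*&(z^Tw)^{-1}w&0\end{array}\right];$$ (2) $M$ is dual core invertible and $$M_{\mathrm{core}}=\left[\begin{array}{cc|cc}0&(x^Ty)^{-1}x^T&0&0\\ s^{-1}\overline{x}&0&0&-as^{-1}(z^Tw)^{-1}\overline{x}z^T\\ \hline 0&0&0&(z^Tw)^{-1}z^T\\ 0&-bt^{-1}(x^Ty)^{-1}\overline{z}x^T&t^{-1}\overline{z}&0\end{array}\right].$$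
   Context: For a matrix $A=[a_{ij}]$ over a field $\mathbb{F}$ with involution $\overline{\,\cdot\,}$ (a field automorphism with $\overline{\overline{c}}=c$), $\overline{A}=[\overline{a_{ij}}]$ and $A^*=\overline{A}^{\,T}$. $\mathcal{R}(A)$ is the range (column space) of $A$. All $4\times4$ block matrices have rows and columns partitioned with sizes $1,m,1,n$; each $0$ is a zero block of the appropriate size. Matrices $M$ of the displayed form (with $a,b$ and all entries of $x,y,z,w$ nonzero) are the matrices whose associated digraph is a double star digraph, in canonical form. For a square matrix $A$: the orthogonal projector onto a subspace $\mathcal{S}$ is a matrix $P=P^2=P^*$ with $\mathcal{R}(P)=\mathcal{S}$ (unique if it exists); $P_A$ denotes the orthogonal projector onto $\mathcal{R}(A)$ and $P_{A^*}$ the one onto $\mathcal{R}(A^* )$. The core inverse $A^{\mathrm{core}}$ is the unique matrix $X$ (if it exists) with $AX=P_A$ and $\mathcal{R}(X)\subseteq\mathcal{R}(A)$. The dual core inverse $A_{\mathrm{core}}$ is the unique matrix $X$ (if it exists) with $XA=P_{A^*}$ and $\mathcal{R}(X^* )\subseteq\mathcal{R}(A^* )$. If both the Moore–Penrose inverse $A^\dagger$ (with respect to $*$) and the group inverse $A^\#$ exist, then $A^{\mathrm{core}}=A^\#AA^\dagger$ and $A_{\mathrm{core}}=A^\dagger AA^\#$. $A$ is called core (dual core) invertible if its core (dual core) inverse exists. *)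

(* Defs.v *)
From HB Require Import structures.
From mathcomp Require Import all_boot all_order all_algebra.

Set Implicit Arguments.
Unset Strict Implicit.
Unset Printing Implicit Defensive.

Import GRing.Theory.
Local Open Scope ring_scope.

Definition conj_mx (F : fieldType) (conj : {rmorphism F -> F}) (m n : nat)
  (A : 'M[F]_(m, n)) : 'M[F]_(m, n) := map_mx conj A.

Definition adjoint_mx (F : fieldType) (conj : {rmorphism F -> F}) (m n : nat)
  (A : 'M[F]_(m, n)) : 'M[F]_(n, m) := (conj_mx conj A)^T.

(* The %MS relations compare row spaces, hence the transpositions: the range
   R(A) is the column space of A. *)
Definition range_sub (F : fieldType) (m n p : nat)
  (A : 'M[F]_(m, n)) (B : 'M[F]_(m, p)) : bool := (A^T <= B^T)%MS.

Definition range_eq (F : fieldType) (m n p : nat)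
  (A : 'M[F]_(m, n)) (B : 'M[F]_(m, p)) : bool := (A^T == B^T)%MS.

(* The subspace is given as the range of A, so this says P = P_A. *)
Definition is_orth_proj (F : fieldType) (conj : {rmorphism F -> F}) (n p : nat)
  (A : 'M[F]_(n, p)) (P : 'M[F]_n) : Prop :=
  [/\ P = P *m P, P = adjoint_mx conj P & range_eq P A].

Definition is_core_inverse (F : fieldType) (conj : {rmorphism F -> F})
  (n : nat) (A X : 'M[F]_n) : Prop :=
  unique (fun Y => is_orth_proj conj A (A *m Y) /\ range_sub Y A) X.

Definition is_dual_core_inverse (F : fieldType) (conj : {rmorphism F -> F})
  (n : nat) (A X : 'M[F]_n) : Prop :=
  unique (fun Y => is_orth_proj conj (adjoint_mx conj A) (Y *m A) /\
                   range_sub (adjoint_mx conj Y) (adjoint_mx conj A)) X.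

Definition core_invertible (F : fieldType) (conj : {rmorphism F -> F})
  (n : nat) (A : 'M[F]_n) : Prop :=
  exists X : 'M[F]_n, is_core_inverse conj A X.

Definition dual_core_invertible (F : fieldType) (conj : {rmorphism F -> F})
  (n : nat) (A : 'M[F]_n) : Prop :=
  exists X : 'M[F]_n, is_dual_core_inverse conj A X.

Definition double_star_mx (F : fieldType) (m n : nat)
  (x y : 'cV[F]_m) (z w : 'cV[F]_n) (a b : F) : 'M[F]_((1 + m) + (1 + n)) :=
  block_mx (block_mx 0 x^T y 0) (block_mx a%:M 0 0 0)
           (block_mx b%:M 0 0 0) (block_mx 0 z^T w 0).

(* Main.v *)
Require Import Defs.
From HB Require Import structures.
From mathcomp Require Import all_boot all_order all_algebra.

Set Implicit Arguments.
Unset Strict Implicit.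
Unset Printing Implicit Defensive.

Import GRing.Theory.
Local Open Scope ring_scope.

(** The matrix identities
      (M X)^* = M X,  X M^2 = M  and  M X^2 = X
    suffice for X to be the core inverse of M.  They imply M X M = M,
    so that M X is the orthogonal projector onto the range of M; and X M^2 = M
    makes M injective on its own range, which gives uniqueness
    ([core_inverse_of_equations]).

    For the double star matrix M and the displayed X both products are block
    diagonal:
      M X = diag(1, u^-1 y y^*, 1, v^-1 w w^* ),
      X M = diag(1, (x^T y)^-1 y x^T, 1, (z^T w)^-1 w z^T ).
    The four nontrivial blocks are rank one projectors fixing y or w, and those
    of M X are Hermitian, so the three identities can be read off blockwise
    ([core_inverse_double_star]).

    The dual statement needs no second computation.  The adjoint exchanges core
    and dual core inverses ([dual_core_inverse_of_adjoint]), and M^* is again a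
    double star matrix: replace (x, y, z, w, a, b) by the entrywise conjugates
    of (y, x, w, z, b, a). *)

(** * Adjoints and orthogonal projectors *)

Section Adjoint.

Variables (F : fieldType) (conj : {rmorphism F -> F}).
Hypothesis conjK : involutive conj.

Local Notation adj := (adjoint_mx conj).

Lemma conj_mxK m n : cancel (@conj_mx F conj m n) (@conj_mx F conj m n).
Proof. by move=> A; apply/matrixP=> i j; rewrite !mxE conjK. Qed.

Lemma adjoint_mxK m n (A : 'M[F]_(m, n)) : adj (adj A) = A.
Proof. by apply/matrixP=> i j; rewrite !mxE conjK. Qed.

Lemma adjoint_conj_mx m n (A : 'M[F]_(m, n)) : adj (conj_mx conj A) = A^T.
Proof. by rewrite /adjoint_mx conj_mxK. Qed.

Lemma adjoint_trmx m n (A : 'M[F]_(m, n)) : adj A^T = conj_mx conj A.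
Proof. by rewrite /adjoint_mx /conj_mx map_trmx trmxK. Qed.

Lemma adjoint_mxM m n p (A : 'M[F]_(m, n)) (B : 'M[F]_(n, p)) :
  adj (A *m B) = adj B *m adj A.
Proof. by rewrite /adjoint_mx /conj_mx map_mxM trmx_mul. Qed.

Lemma adjoint_mxZ m n c (A : 'M[F]_(m, n)) : adj (c *: A) = conj c *: adj A.
Proof. by rewrite /adjoint_mx /conj_mx map_mxZ linearZ. Qed.

Lemma adjoint_mx0 m n : adj (0 : 'M[F]_(m, n)) = 0.
Proof. by rewrite /adjoint_mx /conj_mx map_mx0 trmx0. Qed.

Lemma adjoint_scalar_mx n c : adj (c%:M : 'M[F]_n) = (conj c)%:M.
Proof. by rewrite /adjoint_mx /conj_mx map_scalar_mx tr_scalar_mx. Qed.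

Lemma adjoint_block_mx m1 m2 n1 n2
    (A : 'M[F]_(m1, n1)) (B : 'M[F]_(m1, n2))
    (C : 'M[F]_(m2, n1)) (D : 'M[F]_(m2, n2)) :
  adj (block_mx A B C D) = block_mx (adj A) (adj C) (adj B) (adj D).
Proof. by rewrite /adjoint_mx /conj_mx map_block_mx tr_block_mx. Qed.

Lemma adjoint_mulmx_col m (y : 'cV[F]_m) :
  adj y *m y = (\sum_i y i 0 * conj (y i 0))%:M.
Proof.
rewrite [LHS]mx11_scalar mxE; congr (_%:M).
by apply: eq_bigr => i _; rewrite !mxE mulrC.
Qed.

Lemma conj_sum_norm m (y : 'cV[F]_m) :
  conj (\sum_i y i 0 * conj (y i 0)) = \sum_i y i 0 * conj (y i 0).
Proof.
by rewrite rmorph_sum; apply: eq_bigr => i _; rewrite rmorphM /= conjK mulrC.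
Qed.

Lemma sum_norm_conj_mx m (x : 'cV[F]_m) :
  \sum_i conj_mx conj x i 0 * conj (conj_mx conj x i 0) =
  \sum_i x i 0 * conj (x i 0).
Proof. by apply: eq_bigr => i _; rewrite !mxE conjK mulrC. Qed.

Lemma dot_conj_mx m (x y : 'cV[F]_m) :
  ((conj_mx conj y)^T *m conj_mx conj x) 0 0 = conj ((x^T *m y) 0 0).
Proof.
rewrite !mxE rmorph_sum; apply: eq_bigr => i _.
by rewrite !mxE rmorphM mulrC.
Qed.

Lemma range_subP m n p (A : 'M[F]_(m, n)) (B : 'M[F]_(m, p)) :
  reflect (exists D, A = B *m D) (range_sub A B).
Proof.
apply: (iffP submxP) => [] [D defA]; exists D^T.
  by apply: trmx_inj; rewrite trmx_mul trmxK.
by rewrite defA trmx_mul.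
Qed.

Lemma idempotent_range_sub_mul m p (P : 'M[F]_m) (A : 'M[F]_(m, p)) :
  P = P *m P -> range_sub A P -> P *m A = A.
Proof. by move=> idP /range_subP[D ->]; rewrite mulmxA -idP. Qed.

(** Two Hermitian idempotents with the same range fix each other, so
    P = Q P = (P Q)^* = Q^* = Q. *)
Lemma orth_proj_uniq m p (A : 'M[F]_(m, p)) (P Q : 'M[F]_m) :
  is_orth_proj conj A P -> is_orth_proj conj A Q -> P = Q.
Proof.
case=> idP hermP /andP[PA AP] [idQ hermQ /andP[QA AQ]].
have QP : Q *m P = P by apply: idempotent_range_sub_mul (submx_trans PA AQ).
have PQ : P *m Q = Q by apply: idempotent_range_sub_mul (submx_trans QA AP).
by rewrite -QP {1}hermQ {1}hermP -adjoint_mxM PQ -hermQ.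
Qed.

(** * Core and dual core inverses *)

(** Substituting M = X M^2 in M X M gives (M X^2) M^2 = X M^2 = M, hence M X is
    idempotent with the range of M.  A second solution Y has M Y = M X, both
    being the orthogonal projector onto the range of M, and Y - X = M D for some
    D; then M D = X M (M D) = X (M Y - M X) = 0. *)
Lemma core_inverse_of_equations n (M X : 'M[F]_n) :
    adj (M *m X) = M *m X -> X *m M *m M = M -> M *m X *m X = X ->
  is_core_inverse conj M X.
Proof.
move=> herm XMM MXX.
have MXM : M *m X *m M = M.
  by rewrite -{2}XMM !mulmxA MXX.
have rX : range_sub X M by apply/range_subP; exists (X *m X); rewrite mulmxA.
have projX : is_orth_proj conj M (M *m X).
  split=> //; first by rewrite !mulmxA MXM.
  by apply/andP; split; apply/range_subP; [exists X | exists M].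
split=> // Y [projY /range_subP[E defY]].
have /range_subP[D defX] := rX.
have eqMYX : M *m Y = M *m X by apply: orth_proj_uniq projY projX.
apply/esym/eqP; rewrite -subr_eq0; apply/eqP.
have defYX : Y - X = M *m (E - D) by rewrite mulmxBr -defY -defX.
by rewrite defYX -{1}XMM -!mulmxA -defYX mulmxBr eqMYX subrr mulmx0.
Qed.

(** The two defining conditions correspond under the adjoint because a
    projector is its own adjoint: Y M = (Y M)^* = M^* Y^*. *)
Lemma dual_core_inverse_of_adjoint n (M X : 'M[F]_n) :
  is_core_inverse conj (adj M) (adj X) -> is_dual_core_inverse conj M X.
Proof.
case=> -[proj rX uniqX]; split=> [|Y [projY rY]].
  split=> //; case: (proj) => _ + _.
  by rewrite -adjoint_mxM adjoint_mxK => <-; rewrite adjoint_mxM.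
apply: (can_inj (@adjoint_mxK n n)); apply: uniqX; split=> //.
by case: (projY) => _ + _; rewrite -adjoint_mxM => <-.
Qed.

(** * Double star matrices *)

Lemma adjoint_double_star_mx m n (x y : 'cV[F]_m) (z w : 'cV[F]_n) (a b : F) :
  adj (double_star_mx x y z w a b) =
  double_star_mx (conj_mx conj y) (conj_mx conj x)
                 (conj_mx conj w) (conj_mx conj z) (conj b) (conj a).
Proof.
rewrite /double_star_mx !adjoint_block_mx !adjoint_mx0 !adjoint_scalar_mx.
by rewrite adjoint_trmx adjoint_trmx.
Qed.

Lemma rank1_projection_fix m (y : 'cV[F]_m) (r : 'rV[F]_m) k :
  r *m y = k%:M -> k != 0 -> (k^-1 *: (y *m r)) *m y = y.
Proof.
move=> ry k0.
by rewrite -scalemxAl -mulmxA ry mul_mx_scalar scalerA mulVf // scale1r.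
Qed.

Definition double_star_core m n (x y : 'cV[F]_m) (z w : 'cV[F]_n) (a b : F)
    : 'M[F]_((1 + m) + (1 + n)) :=
  let u := \sum_i y i 0 * conj (y i 0) in
  let v := \sum_i w i 0 * conj (w i 0) in
  let xy := (x^T *m y) 0 0 in
  let zw := (z^T *m w) 0 0 in
  block_mx
    (block_mx 0 (u^-1 *: adj y) (xy^-1 *: y) 0)
    (block_mx 0 0 0 (- (a * v^-1 * xy^-1) *: (y *m adj w)))
    (block_mx 0 0 0 (- (b * u^-1 * zw^-1) *: (w *m adj y)))
    (block_mx 0 (v^-1 *: adj w) (zw^-1 *: w) 0).

Section DoubleStarCore.

Variables (m n : nat) (x y : 'cV[F]_m) (z w : 'cV[F]_n) (a b : F).

Let u := \sum_i y i 0 * conj (y i 0).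
Let v := \sum_i w i 0 * conj (w i 0).
Let xy := (x^T *m y) 0 0.
Let zw := (z^T *m w) 0 0.
Let M := double_star_mx x y z w a b.
Let X := double_star_core x y z w a b.

Hypotheses (xy0 : xy != 0) (zw0 : zw != 0) (u0 : u != 0) (v0 : v != 0).

Let yyE : adj y *m y = u%:M. Proof. exact: adjoint_mulmx_col. Qed.
Let wwE : adj w *m w = v%:M. Proof. exact: adjoint_mulmx_col. Qed.
Let xyE : x^T *m y = xy%:M. Proof. exact: mx11_scalar. Qed.
Let zwE : z^T *m w = zw%:M. Proof. exact: mx11_scalar. Qed.

(** The y w^* and w y^* blocks of X are there to cancel the edges a and b
    joining the two stars: the off-diagonal blocks of M X sum to zero. *)
Lemma double_star_mul_core :
  M *m X = block_mx (block_mx 1%:M 0 0 (u^-1 *: (y *m adj y))) 0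
                    0 (block_mx 1%:M 0 0 (v^-1 *: (w *m adj w))).
Proof.
rewrite /M /X /double_star_mx /double_star_core -/u -/v -/xy -/zw.
rewrite !mulmx_block !(mul0mx, mulmx0, addr0, add0r) !add_block_mx.
rewrite !(mulmxA, addr0, add0r, =^~ scalemxAr).
rewrite xyE zwE !mul_scalar_mx !scalerA !scale_scalar_mx !mulVf //.
have -> : - (a * v^-1 * xy^-1) * xy = - (a * v^-1).
  by rewrite mulNr mulfVK.
have -> : - (b * u^-1 * zw^-1) * zw = - (b * u^-1).
  by rewrite mulNr mulfVK.
by rewrite ![_^-1 * _]mulrC !scaleNr addNr subrr !block_mx0.
Qed.

Lemma core_mul_double_star :
  X *m M = block_mx (block_mx 1%:M 0 0 (xy^-1 *: (y *m x^T))) 0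
                    0 (block_mx 1%:M 0 0 (zw^-1 *: (w *m z^T))).
Proof.
rewrite /M /X /double_star_mx /double_star_core -/u -/v -/xy -/zw.
rewrite !mulmx_block !(mul0mx, mulmx0, addr0, add0r) !add_block_mx.
rewrite !(addr0, add0r, =^~ scalemxAl) -!mulmxA yyE wwE.
rewrite !mul_mx_scalar !scalerA !scale_scalar_mx !mulVf //.
have -> : - (a * v^-1 * xy^-1) * v = - (a * xy^-1).
  by rewrite mulNr mulrAC mulfVK.
have -> : - (b * u^-1 * zw^-1) * u = - (b * zw^-1).
  by rewrite mulNr mulrAC mulfVK.
by rewrite ![_^-1 * _]mulrC !scaleNr addNr subrr !block_mx0.
Qed.

Lemma core_inverse_double_star : is_core_inverse conj M X.
Proof.
apply: core_inverse_of_equations.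
- rewrite double_star_mul_core !adjoint_block_mx !adjoint_mx0.
  rewrite !adjoint_scalar_mx !adjoint_mxZ !adjoint_mxM !adjoint_mxK.
  by rewrite !fmorphV !conj_sum_norm rmorph1.
- rewrite core_mul_double_star /M /double_star_mx.
  rewrite !mulmx_block !(mul0mx, mulmx0, addr0, add0r, mul1mx).
  by rewrite !rank1_projection_fix.
- rewrite double_star_mul_core /X /double_star_core -/u -/v -/xy -/zw.
  rewrite !mulmx_block !(mul0mx, mulmx0, addr0, add0r, mul1mx).
  by rewrite -!scalemxAr !(mulmxA _ y) !(mulmxA _ w) !rank1_projection_fix.
Qed.

End DoubleStarCore.

(** * The dual core inverse of a double star matrix *)

Definition double_star_dual_core m n
    (x y : 'cV[F]_m) (z w : 'cV[F]_n) (a b : F) : 'M[F]_((1 + m) + (1 + n)) :=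
  let s := \sum_i x i 0 * conj (x i 0) in
  let t := \sum_i z i 0 * conj (z i 0) in
  let xy := (x^T *m y) 0 0 in
  let zw := (z^T *m w) 0 0 in
  block_mx
    (block_mx 0 (xy^-1 *: x^T) (s^-1 *: conj_mx conj x) 0)
    (block_mx 0 0 0 (- (a * s^-1 * zw^-1) *: (conj_mx conj x *m z^T)))
    (block_mx 0 0 0 (- (b * t^-1 * xy^-1) *: (conj_mx conj z *m x^T)))
    (block_mx 0 (zw^-1 *: z^T) (t^-1 *: conj_mx conj z) 0).

(** The parameters on the right are those of the adjoint of the double star
    matrix: the displayed dual core inverse is the adjoint of the core inverse
    of the adjoint. *)
Lemma adjoint_double_star_dual_core m n
    (x y : 'cV[F]_m) (z w : 'cV[F]_n) (a b : F) :
  adj (double_star_dual_core x y z w a b) =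
  double_star_core (conj_mx conj y) (conj_mx conj x)
                   (conj_mx conj w) (conj_mx conj z) (conj b) (conj a).
Proof.
rewrite /double_star_core !sum_norm_conj_mx !dot_conj_mx.
rewrite !adjoint_block_mx !adjoint_mx0 !adjoint_mxZ !adjoint_mxM.
rewrite !adjoint_conj_mx !adjoint_trmx !rmorphN !rmorphM !fmorphV /=.
by rewrite !conj_sum_norm.
Qed.

Lemma dual_core_inverse_double_star m n
    (x y : 'cV[F]_m) (z w : 'cV[F]_n) (a b : F) :
    (x^T *m y) 0 0 != 0 -> (z^T *m w) 0 0 != 0 ->
    \sum_i x i 0 * conj (x i 0) != 0 -> \sum_i z i 0 * conj (z i 0) != 0 ->
  is_dual_core_inverse conj (double_star_mx x y z w a b)
    (double_star_dual_core x y z w a b).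
Proof.
move=> xy0 zw0 s0 t0; apply: dual_core_inverse_of_adjoint.
rewrite adjoint_double_star_mx adjoint_double_star_dual_core.
by apply: core_inverse_double_star;
  rewrite ?dot_conj_mx ?fmorph_eq0 ?sum_norm_conj_mx.
Qed.

End Adjoint.

Theorem proposition3p1 (F : fieldType) (conj : {rmorphism F -> F})
  (conjK : involutive conj) (m n : nat) (hm : (1 <= m)%N) (hn : (1 <= n)%N)
  (x y : 'cV[F]_m) (z w : 'cV[F]_n) (a b : F)
  (hx : forall i, x i 0 != 0) (hy : forall i, y i 0 != 0)
  (hz : forall i, z i 0 != 0) (hw : forall i, w i 0 != 0)
  (ha : a != 0) (hb : b != 0) :
  let M := double_star_mx x y z w a b in
  let s := \sum_i x i 0 * conj (x i 0) in
  let u := \sum_i y i 0 * conj (y i 0) in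
  let t := \sum_i z i 0 * conj (z i 0) in
  let v := \sum_i w i 0 * conj (w i 0) in
  let xy := (x^T *m y) 0 0 in
  let zw := (z^T *m w) 0 0 in
  xy != 0 -> zw != 0 -> s != 0 -> u != 0 -> t != 0 -> v != 0 ->
  (core_invertible conj M /\
   is_core_inverse conj M
     (block_mx
        (block_mx 0 (u^-1 *: adjoint_mx conj y)
                  (xy^-1 *: y) 0)
        (block_mx 0 0
                  0 (- (a * v^-1 * xy^-1) *: (y *m adjoint_mx conj w)))
        (block_mx 0 0
                  0 (- (b * u^-1 * zw^-1) *: (w *m adjoint_mx conj y)))
        (block_mx 0 (v^-1 *: adjoint_mx conj w)
                  (zw^-1 *: w) 0))) /\
  (dual_core_invertible conj M /\
   is_dual_core_inverse conj M
     (block_mx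
        (block_mx 0 (xy^-1 *: x^T)
                  (s^-1 *: conj_mx conj x) 0)
        (block_mx 0 0
                  0 (- (a * s^-1 * zw^-1) *: (conj_mx conj x *m z^T)))
        (block_mx 0 0
                  0 (- (b * t^-1 * xy^-1) *: (conj_mx conj z *m x^T)))
        (block_mx 0 (zw^-1 *: z^T)
                  (t^-1 *: conj_mx conj z) 0))).
Proof.
move=> M s u t v xy zw xy0 zw0 s0 u0 t0 v0.
have coreM := core_inverse_double_star conjK a b xy0 zw0 u0 v0.
have dualM := dual_core_inverse_double_star conjK a b xy0 zw0 s0 t0.
by split; split=> //; eexists; eassumption.
Qed.
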